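(* Let $\mathbf{M}=(M;\le,0,1)$ be a non-trivial complete lattice, let $S$ and $X$ be non-empty sets, and let $\mathbf{B}=(B;\le,0,1)$ be a bounded subposet of $\mathbf{M}^{S}$. Let $P=(P_x)_{x\in X}\colon B\to (M^{S})^{X}$ and $T=(T_x)_{x\in X}\colon B\to (M^{S})^{X}$ be order-preserving maps such that for all $a,b\in B$ and all $x\in X$, $$P_x(a)\le b \iff a\le T_x(b).$$ Let $R_T\subseteq X\times S\times S$ and $R^{P}\subseteq X\times S\times S$ be the upper $T$-induced and lower $P$-induced state-transition relations. Then: (a) If $P_x(b)\in B$ for all $x\in X$ and $b\in B$, then $R_T\subseteq R^{P}$. (b) If $T_x(b)\in B$ for all $x\in X$ and $b\in B$, then $R^{P}\subseteq R_T$. (c) If both $P_x(b)\in B$ and $T_x(b)\in B$ for all $x\in X$ and $b\in B$, then $R_T=R^{P}$, i.e. the upper $T$-induced automaton $(X,S,R_T)$ equals the lower $P$-induced automaton $(X,S,R^{P})$.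
   Context: $\mathbf{M}^S$ is the set of all maps $S\to M$ ordered pointwise; a bounded subposet $\mathbf{B}$ of $\mathbf{M}^S$ is a subset containing the constant maps $0$ and $1$, with the induced order. For $p\in M^S$ and $s\in S$, $p(s)$ denotes the value of $p$ at $s$. For each $x\in X$ define the relations on $S$ $$R_{T_x}=\{(s,t)\in S\times S\mid \forall b\in B:\ T_x(b)(s)\le b(t)\},\qquad R^{P_x}=\{(s,t)\in S\times S\mid \forall a\in B:\ a(s)\le P_x(a)(t)\}.$$ The upper $T$-induced state-transition relation is $R_T=\bigcup_{x\in X}\{x\}\times R_{T_x}$ and the lower $P$-induced state-transition relation is $R^{P}=\bigcup_{x\in X}\{x\}\times R^{P_x}$. An automaton is a triple $(X,S,R)$ with $R\subseteq X\times S\times S$. *)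

(* Defs.v *)
From HB Require Import structures.
From mathcomp Require Import all_boot all_order.
From mathcomp Require Import boolp classical_sets.

Set Implicit Arguments.
Unset Strict Implicit.
Unset Printing Implicit Defensive.

Import Order.TTheory.

Local Open Scope classical_set_scope.
Local Open Scope order_scope.

Definition complete_lattice (d : Order.disp_t) (M : tbLatticeType d) : Prop :=
  forall A : set M, supremums A !=set0 /\ infimums A !=set0.

Definition bounded_subposet (d : Order.disp_t) (M : tbLatticeType d) (S : Type)
    (B : set (S -> M)) : Prop :=
  B (fun=> \bot) /\ B (fun=> \top).

(* A map F : B -> (M^S)^X is a function out of the subtype of S -> M carved out
   by B, with F b x standing for F_x(b). The order induced on B is the order of
   S -> M along \val; function types carry the pointwise order. *)

Definition order_preserving (d : Order.disp_t) (M : tbLatticeType d)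
    (S X : Type) (B : set (S -> M)) (F : B -> X -> S -> M) : Prop :=
  forall a b : B, \val a <= \val b -> F a <= F b.

Definition upper_rel (d : Order.disp_t) (M : tbLatticeType d) (S X : Type)
    (B : set (S -> M)) (T : B -> X -> S -> M) (x : X) : set (S * S) :=
  [set st | forall b : B, T b x st.1 <= \val b st.2].

Definition lower_rel (d : Order.disp_t) (M : tbLatticeType d) (S X : Type)
    (B : set (S -> M)) (P : B -> X -> S -> M) (x : X) : set (S * S) :=
  [set st | forall a : B, \val a st.1 <= P a x st.2].

Definition upper_transition (d : Order.disp_t) (M : tbLatticeType d)
    (S X : Type) (B : set (S -> M)) (T : B -> X -> S -> M) :
    set (X * (S * S)) :=
  \bigcup_(x : X) ([set x] `*` upper_rel T x).

Definition lower_transition (d : Order.disp_t) (M : tbLatticeType d)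
    (S X : Type) (B : set (S -> M)) (P : B -> X -> S -> M) :
    set (X * (S * S)) :=
  \bigcup_(x : X) ([set x] `*` lower_rel P x).

Record automaton := Automaton {
  inputs : Type;
  states : Type;
  transitions : set (inputs * (states * states))
}.

Definition upper_automaton (d : Order.disp_t) (M : tbLatticeType d)
    (S X : Type) (B : set (S -> M)) (T : B -> X -> S -> M) : automaton :=
  @Automaton X S (upper_transition T).

Definition lower_automaton (d : Order.disp_t) (M : tbLatticeType d)
    (S X : Type) (B : set (S -> M)) (P : B -> X -> S -> M) : automaton :=
  @Automaton X S (lower_transition P).

(* Main.v *)
(* By the adjunction, [P_x a <= P_x a] gives [a <= T_x (P_x a)] as soon as
   [P_x a] lies in [B]; testing membership of [(s, t)] in the relation of [T_x]
   at [b = P_x a] then yields [a s <= T_x b s <= P_x a t]. The other inclusion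
   is dual, through [P_x (T_x b) <= b]. *)

Require Import Defs.
From HB Require Import structures.
From mathcomp Require Import all_boot all_order.
From mathcomp Require Import boolp classical_sets.

Set Implicit Arguments.
Unset Strict Implicit.
Unset Printing Implicit Defensive.

Import Order.TTheory.

Local Open Scope classical_set_scope.
Local Open Scope order_scope.

Lemma upper_rel_sub_lower_rel (d : Order.disp_t) (M : tbLatticeType d)
    (S X : Type) (B : set (S -> M)) (P T : B -> X -> S -> M) (x : X) :
  (forall a b : B, P a x <= \val b -> \val a <= T b x) ->
  (forall b : B, B (P b x)) -> upper_rel T x `<=` lower_rel P x.
Proof.
move=> PT PB [s t] /= Tst a.
pose b : B := SigSub (mem_set (PB a)).
(* [\val b] is convertible to [P a x], so the premise of [PT] is reflexivity; [lefP] then evaluates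
   the pointwise inequality at the source state [s]. *)
have /lefP/(_ s) aT : \val a <= T b x by exact: PT.
exact: le_trans aT (Tst b).
Qed.

Lemma lower_rel_sub_upper_rel (d : Order.disp_t) (M : tbLatticeType d)
    (S X : Type) (B : set (S -> M)) (P T : B -> X -> S -> M) (x : X) :
  (forall a b : B, \val a <= T b x -> P a x <= \val b) ->
  (forall b : B, B (T b x)) -> lower_rel P x `<=` upper_rel T x.
Proof.
move=> TP TB [s t] /= Pst b.
pose a : B := SigSub (mem_set (TB b)).
(* Now the evaluation is at the target state [t], because [Pst a] bounds [T b x s] by [P a x t]. *)
have /lefP/(_ t) Pb : P a x <= \val b by exact: TP.
exact: le_trans (Pst a) Pb.
Qed.

Theorem theorem2 (d : Order.disp_t) (M : tbLatticeType d) (S X : Type)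
    (B : set (S -> M)) (P T : B -> X -> S -> M)
    (M_complete : complete_lattice M)
    (M_nontrivial : (\bot : M) <> \top)
    (S_nonempty : inhabited S) (X_nonempty : inhabited X)
    (B_bounded : bounded_subposet B)
    (P_mono : order_preserving P) (T_mono : order_preserving T)
    (PT_adj : forall (a b : B) (x : X), P a x <= \val b <-> \val a <= T b x) :
  ((forall (x : X) (b : B), B (P b x)) ->
     upper_transition T `<=` lower_transition P) /\
  ((forall (x : X) (b : B), B (T b x)) ->
     lower_transition P `<=` upper_transition T) /\
  ((forall (x : X) (b : B), B (P b x)) ->
   (forall (x : X) (b : B), B (T b x)) ->
     upper_transition T = lower_transition P /\
     upper_automaton T = lower_automaton P).
Proof.
have upper_lower : (forall x b, B (P b x)) ->
    upper_transition T `<=` lower_transition P.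
  (* Both unions tag each pair with its input, so the inclusion is checked one input at a time. *)
  move=> PB; apply: subset_bigcup => x _; apply: setSX => //.
  by apply: upper_rel_sub_lower_rel => // a b /PT_adj.
have lower_upper : (forall x b, B (T b x)) ->
    lower_transition P `<=` upper_transition T.
  move=> TB; apply: subset_bigcup => x _; apply: setSX => //.
  by apply: lower_rel_sub_upper_rel => // a b /PT_adj.
split=> //; split=> // PB TB.
have RTP : upper_transition T = lower_transition P.
  by apply/seteqP; split; [exact: upper_lower | exact: lower_upper].
(* The two records have the same input and state types, so rewriting the transition set identifies
   them without any transport. *)
by split=> //; rewrite /upper_automaton RTP.
Qed.
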